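(* Let $r\ge 1$, $s\ge 0$ be integers, $\alpha_1,\ldots,\alpha_r\in\mathbb{C}$, $\beta_1,\ldots,\beta_s\in\mathbb{C}\setminus\mathbb{Z}_{\le 0}$, $x\ge 0$, and let $\Re(p)>0$ or $p=0$, with $\Re(\alpha_1)>0$ in case $p=x=0$. Then for every integer $n\ge 0$, $$\frac{d^{n}}{dz^{n}}\left\{{}_{r}\Gamma_{s}\left[\begin{array}{r}(\alpha_{1},x;p),\alpha_{2},\ldots,\alpha_{r};\\ \beta_{1},\ldots,\beta_{s};\end{array} z\right]\right\}=\frac{(\alpha_{1})_{n}\cdots(\alpha_{r})_{n}}{(\beta_{1})_{n}\cdots(\beta_{s})_{n}}\;{}_{r}\Gamma_{s}\left[\begin{array}{r}(\alpha_{1}+n,x;p),\alpha_{2}+n,\ldots,\alpha_{r}+n;\\ \beta_{1}+n,\ldots,\beta_{s}+n;\end{array} z\right],$$ provided that each member of this equation exists.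
   Context: Generalized incomplete Gamma function: $\Gamma(\nu,x;p):=\int_x^\infty t^{\nu-1}e^{-t-p/t}\,dt$ for $x\ge 0$ and $\Re(p)>0$ (also for $p=0$ whenever the integral converges). Extended incomplete Pochhammer symbol: $[\lambda;x,p]_\nu:=\Gamma(\lambda+\nu,x;p)/\Gamma(\lambda)$, where $1/\Gamma(\lambda)$ is read as $0$ for $\lambda\in\mathbb{Z}_{\le0}$. Ordinary Pochhammer symbol: $(\lambda)_0=1$, $(\lambda)_n=\lambda(\lambda+1)\cdots(\lambda+n-1)$. Extended incomplete generalized hypergeometric function (when the series converges): $${}_{r}\Gamma_{s}\left[\begin{array}{r}(\alpha_{1},x;p),\alpha_{2},\ldots,\alpha_{r};\\ \beta_{1},\ldots,\beta_{s};\end{array} z\right]:=\sum_{n=0}^{\infty}\frac{[\alpha_{1};x,p]_{n}(\alpha_{2})_{n}\cdots(\alpha_{r})_{n}}{(\beta_{1})_{n}\cdots(\beta_{s})_{n}}\frac{z^{n}}{n!}.$$ Existence of the left member means that the series converges in a neighbourhood of $z$ and its $n$-th complex derivative is taken there; existence of the right member means that its series converges at $z$. *)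

(* Defs.v *)
(* Stdlib reals, with Coquelicot for complex numbers, integrals and series. *)
From Stdlib Require Import Reals Factorial List ClassicalEpsilon.
From Coquelicot Require Import Coquelicot.

Open Scope C_scope.

Definition Cexp (z : C) : C :=
  RtoC (exp (Re z)) * (cos (Im z), sin (Im z)).

(* The lower endpoint is approached from the right, so that for [x = 0] the
   integral is improper at both ends and the integrand is only used at [t > 0],
   where [t ^ (nu - 1)] is [Cexp ((nu - 1) * ln t)]. *)
Definition inc_Gamma (nu : C) (x : R) (p : C) : C :=
  RInt_gen (V := C_R_CompleteNormedModule)
    (fun t : R => Cexp ((nu - 1) * RtoC (ln t)) * Cexp (- RtoC t - p / RtoC t))
    (at_right x) (Rbar_locally p_infty).

Fixpoint Cpoch (a : C) (n : nat) : C :=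
  match n with
  | O => 1
  | S m => Cpoch a m * (a + RtoC (INR m))
  end.

Definition nonpos_int (a : C) : Prop := exists k : nat, a = - RtoC (INR k).

(* Euler's integral for [0 < Re a], continued by
   [Gamma a = Gamma (a + k) / (a)_k]; here [k] is the least natural number with
   [0 < Re a + k], so [k = 0] when [0 < Re a].
   Junk value when [nonpos_int a]. *)
Definition CGamma (a : C) : C :=
  let k := Z.to_nat (up (- Re a)) in
  inc_Gamma (a + RtoC (INR k)) 0 0 / Cpoch a k.

Definition inv_CGamma (a : C) : C :=
  if excluded_middle_informative (nonpos_int a) then 0 else / CGamma a.

Definition inc_poch (a : C) (x : R) (p : C) (n : nat) : C :=
  inc_Gamma (a + RtoC (INR n)) x p * inv_CGamma a.

Definition Cpoch_prod (l : list C) (n : nat) : C :=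
  fold_right (fun a acc => Cpoch a n * acc) 1 l.

Definition Cshift (n : nat) (l : list C) : list C :=
  map (fun a => a + RtoC (INR n)) l.

Definition ex_Cseries (u : nat -> C) : Prop :=
  ex_series (K := C_AbsRing) (V := C_NormedModule) u.

(* [iota] needs a complete normed module; [C] over [R] and [C] over itself carry
   the same topology. The value is meaningful only when [ex_Cseries u]. *)
Definition Cseries (u : nat -> C) : C :=
  iota (T := C_R_CompleteNormedModule)
    (fun l : C => is_series (K := C_AbsRing) (V := C_NormedModule) u l).

(* The numerator parameters are [alpha1] and the entries of [alphas], so
   [r = 1 + length alphas] and [s = length betas]. *)
Definition rGammas_term (alpha1 : C) (alphas betas : list C)
    (x : R) (p z : C) (n : nat) : C :=
  inc_poch alpha1 x p n * Cpoch_prod alphas n / Cpoch_prod betas n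
  * (z ^ n / RtoC (INR (fact n))).

Definition rGammas (alpha1 : C) (alphas betas : list C)
    (x : R) (p z : C) : C :=
  Cseries (rGammas_term alpha1 alphas betas x p z).

(* "The [n]-th complex derivative of [f] at [z] exists and equals [l]": each
   lower order derivative is required to exist on a neighbourhood of [z]. *)
Fixpoint is_C_derive_n (f : C -> C) (n : nat) (z l : C) : Prop :=
  match n with
  | O => f z = l
  | S m => exists g : C -> C,
      locally z (fun w => is_C_derive_n f m w (g w)) /\
      is_derive (K := C_AbsRing) (V := C_NormedModule) g z l
  end.

(* Main.v *)
Require Import Defs.
From Stdlib Require Import Reals List.
From Stdlib Require Import ZArith Factorial Lra Lia ClassicalEpsilon FunctionalExtensionality.
From Coquelicot Require Import Coquelicot.

(** A series converging in a neighbourhood of [z] has radius of convergence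
    larger than [|z|], so it may be differentiated term by term, and the [k]-th
    coefficient of the [n]-th derivative is [(n + k)! / k!] times the coefficient
    of index [n + k]. Since [(a)_(n + k) = (a)_n (a + n)_k], everything reduces to
    [1 / Gamma a = (a)_n / Gamma (a + n)], that is, to the functional equation of
    the Gamma function, obtained from Euler's integral by parts. *)

(** * Complex power series *)

(** A remainder of order |w - z|^2 is at most eps |w - z| once |w - z| < eps / M. Differentiating a
    series thus reduces to summing bounds on the remainders of its terms. *)
Lemma is_C_derive_of_quadratic_bound (f : C -> C) (z l : C) (d M : R) :
  (0 < d) ->
  (forall w, (Cmod (w - z) < d) ->
     (Cmod (f w - f z - l * (w - z)) <= M * (Cmod (w - z) * Cmod (w - z)))) ->
  is_derive (K := C_AbsRing) (V := C_NormedModule) f z l.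
Proof.
intros Hd Hb; split.
- apply (is_linear_scal_l (K := C_AbsRing) (V := C_NormedModule)).
- intros y Hy.
  assert (Eyz : z = y)
    by exact (is_filter_lim_locally_unique (V := AbsRing_NormedModule C_AbsRing) z y Hy).
  subst y; intros eps.
  (* [M] may be zero or negative, so the division is by [Rmax M 1]. *)
  assert (HM : (0 < Rmax M 1)) by (apply Rlt_le_trans with 1; [lra | apply Rmax_r]).
  assert (Hr : (0 < Rmin d (eps / Rmax M 1))).
  { apply Rmin_glb_lt; [exact Hd | apply Rdiv_lt_0_compat; [apply cond_pos | exact HM]]. }
  exists (mkposreal _ Hr); intros w Hw; change C in (type of w).
  change (Cmod (w - z) < Rmin d (eps / Rmax M 1)) in Hw.
  change (Cmod (f w - f z - (w - z) * l) <= eps * Cmod (w - z)).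
  replace (f w - f z - (w - z) * l)%C with (f w - f z - l * (w - z))%C by ring.
  apply Rle_trans with (1 := Hb w (Rlt_le_trans _ _ _ Hw (Rmin_l _ _))).
  rewrite <- Rmult_assoc.
  apply Rmult_le_compat_r; [apply Cmod_ge_0 |].
  assert (Hw' := Rlt_le_trans _ _ _ Hw (Rmin_r _ _)).
  apply Rle_trans with (Rmax M 1 * Cmod (w - z)).
  + apply Rmult_le_compat_r; [apply Cmod_ge_0 | apply Rmax_l].
  + apply Rlt_le; rewrite Rmult_comm; apply Rlt_div_r; assumption.
Qed.

(** The constant is the second derivative of the monomial at [rho], without the Taylor factor 1/2.
    It is chosen so that, weighted by the coefficients of a power series, these bounds add up to the
    twice derived series at [rho]. *)
Lemma Cpow_taylor2_bound (z w : C) (rho : R) (k : nat) :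
  (Cmod z <= rho) -> (Cmod w <= rho) ->
  (Cmod (w ^ S (S k) - z ^ S (S k) - RtoC (INR (S (S k))) * z ^ S k * (w - z))
   <= INR (S (S k)) * INR (S k) * rho ^ k * (Cmod (w - z) * Cmod (w - z))).
Proof.
intros Hz Hw.
assert (Hrho : (0 <= rho)) by (apply Rle_trans with (2 := Hz), Cmod_ge_0).
set (D := (Cmod (w - z) * Cmod (w - z))).
assert (HD : (0 <= D)) by (apply Rmult_le_pos; apply Cmod_ge_0).
induction k as [|k IH].
- replace (w ^ 2 - z ^ 2 - RtoC (INR 2) * z ^ 1 * (w - z))%C with ((w - z) * (w - z))%C
    by (simpl; rewrite !RtoC_plus; ring).
  rewrite Cmod_mult; fold D; simpl; lra.
(* With R_m the first-order remainder of the m-th power, R_(m+1) = w R_m + m z^(m-1) (w - z)^2. *)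
- assert (E : (w ^ S (S (S k)) - z ^ S (S (S k))
      - RtoC (INR (S (S (S k)))) * z ^ S (S k) * (w - z)
    = w * (w ^ S (S k) - z ^ S (S k) - RtoC (INR (S (S k))) * z ^ S k * (w - z))
      + RtoC (INR (S (S k))) * z ^ S k * ((w - z) * (w - z)))%C).
  { rewrite (S_INR (S (S k))), RtoC_plus; rewrite !Cpow_S; ring. }
  rewrite E; clear E.
  eapply Rle_trans; [apply Cmod_triangle |].
  rewrite !Cmod_mult; fold D.
  rewrite Cmod_R, Cmod_pow, Rabs_pos_eq by apply pos_INR.
  assert (H1 : (Cmod w * Cmod (w ^ S (S k) - z ^ S (S k)
                 - RtoC (INR (S (S k))) * z ^ S k * (w - z))
        <= rho * (INR (S (S k)) * INR (S k) * rho ^ k * D)))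
    by (apply Rmult_le_compat; try apply Cmod_ge_0; assumption).
  assert (H2 : (Cmod z ^ S k <= rho ^ S k))
    by (apply pow_incr; split; [apply Cmod_ge_0 | exact Hz]).
  assert (H3 : (INR (S (S k)) * Cmod z ^ S k * D <= INR (S (S k)) * rho ^ S k * D)).
  { apply Rmult_le_compat_r; [exact HD |].
    apply Rmult_le_compat_l; [apply pos_INR | exact H2]. }
  apply Rle_trans with (1 := Rplus_le_compat _ _ _ _ H1 H3).
  assert (H4 : (0 <= rho ^ S k * D)) by (apply Rmult_le_pos; [apply pow_le |]; assumption).
  (* What remains is (k+2)(k+1) + (k+2) <= (k+3)(k+2), times rho^(k+1) |w - z|^2. *)
  rewrite (S_INR (S (S k))), (S_INR (S k)), (S_INR k).
  assert (Hk := pos_INR k).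
  simpl pow in *.
  assert (0 <= INR k * (rho * rho ^ k * D)) by (apply Rmult_le_pos; assumption).
  nra.
Qed.

Lemma is_Cseries_unique (u : nat -> C) (l : C) :
  is_series (K := C_AbsRing) (V := C_NormedModule) u l -> Cseries u = l.
Proof.
intros Hl; unfold Cseries.
apply (iota_unique (V := C_R_CompleteNormedModule)); [| exact Hl].
intros y Hy.
exact (filterlim_locally_unique (V := C_NormedModule) (sum_n u) y l Hy Hl).
Qed.

Lemma Cseries_correct (u : nat -> C) :
  ex_Cseries u -> is_series (K := C_AbsRing) (V := C_NormedModule) u (Cseries u).
Proof.
intros [l Hl]; rewrite (is_Cseries_unique _ _ Hl); exact Hl.
Qed.

Lemma Cseries_ext (u v : nat -> C) : (forall k, u k = v k) -> Cseries u = Cseries v.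
Proof.
intros H; replace v with u; [reflexivity |].
apply functional_extensionality, H.
Qed.

Lemma ex_Cseries_le (u : nat -> C) (b : nat -> R) :
  (forall k, (Cmod (u k) <= b k)) -> ex_series b -> ex_Cseries u.
Proof.
intros H Hb; exact (ex_series_le (V := C_CompleteNormedModule) u b H Hb).
Qed.

Lemma Cmod_is_series_le (u : nat -> C) (b : nat -> R) (l : C) :
  (forall k, (Cmod (u k) <= b k)) -> ex_series b ->
  is_series (K := C_AbsRing) (V := C_NormedModule) u l ->
  (Cmod l <= Series b).
Proof.
intros H Hb Hl.
assert (Hn : is_lim_seq (fun n => Cmod (sum_n (G := C_NormedModule) u n)) (Cmod l)).
{ exact (filterlim_comp _ _ _ _ _ _ _ _ Hl (filterlim_norm (V := C_NormedModule) l)). }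
refine (is_lim_seq_le _ _ (Cmod l) (Series b) _ Hn (Series_correct b Hb)).
intros n; apply Rle_trans with (1 := norm_sum_n_m (V := C_NormedModule) u 0 n).
apply sum_n_m_le; exact H.
Qed.

Definition C_PS_derive (a : nat -> C) (k : nat) : C := RtoC (INR (S k)) * a (S k).

(** Absolute convergence depends only on the moduli of the coefficients, so the real notion of
    radius carries over. *)
Definition C_PS_radius (a : nat -> C) : Rbar := CV_radius (fun k => Cmod (a k)).

Lemma C_PS_radius_derive (a : nat -> C) : C_PS_radius (C_PS_derive a) = C_PS_radius a.
Proof.
unfold C_PS_radius; rewrite <- (CV_radius_derive (fun k => Cmod (a k))).
apply CV_radius_ext; intros k; unfold C_PS_derive, PS_derive.
rewrite Cmod_mult, Cmod_R, Rabs_pos_eq by apply pos_INR; reflexivity.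
Qed.

Lemma ex_series_C_PS_radius (a : nat -> C) (r : R) :
  (0 <= r) -> Rbar_lt r (C_PS_radius a) -> ex_series (fun k => Cmod (a k) * r ^ k).
Proof.
intros Hr H.
apply (ex_series_ext (fun k => Rabs (Cmod (a k) * r ^ k))).
- intros k; apply Rabs_pos_eq, Rmult_le_pos; [apply Cmod_ge_0 | apply pow_le, Hr].
- apply CV_disk_inside; rewrite Rabs_pos_eq; assumption.
Qed.

Lemma ex_Cseries_C_PS_radius (a : nat -> C) (z : C) :
  Rbar_lt (Cmod z) (C_PS_radius a) -> ex_Cseries (fun k => a k * z ^ k)%C.
Proof.
intros H; apply ex_Cseries_le with (fun k => Cmod (a k) * Cmod z ^ k).
- intros k; rewrite Cmod_mult, Cmod_pow; apply Rle_refl.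
- apply ex_series_C_PS_radius; [apply Cmod_ge_0 | exact H].
Qed.

(** Abel's argument: partial sums of a convergent series are bounded, hence so are its terms, and
    bounded terms at [w] keep |w| within the radius. *)
Lemma C_PS_radius_ge (a : nat -> C) (w : C) :
  ex_Cseries (fun k => a k * w ^ k)%C -> Rbar_le (Cmod w) (C_PS_radius a).
Proof.
intros H; destruct (filterlim_bounded (V := C_NormedModule) _ H) as [M HM].
apply (proj1 (CV_radius_bounded _)).
(* Each term after the first is a difference of two partial sums, both bounded by [M]; the first
   term is itself a partial sum. *)
exists (M + M); intros k.
rewrite <- (Cmod_pow w k), <- Cmod_mult, Rabs_pos_eq by apply Cmod_ge_0.
destruct k as [|k].
- apply Rle_trans with M.
  + generalize (HM O); rewrite sum_O; intros H0; exact H0.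
  + assert (0 <= M) by (apply Rle_trans with (2 := HM O), norm_ge_0); lra.
- replace (a (S k) * w ^ S k)%C
    with (minus (sum_n (G := C_NormedModule) (fun k => a k * w ^ k)%C (S k))
            (sum_n (G := C_NormedModule) (fun k => a k * w ^ k)%C k)).
  + eapply Rle_trans; [apply (norm_triangle (V := C_NormedModule)) |].
    rewrite norm_opp; apply Rplus_le_compat; apply HM.
  + rewrite sum_Sn.
    set (s := sum_n _ k); set (t := (_ * _)%C).
    change (s + t - s = t)%C; ring.
Qed.

Lemma is_Cseries_shift (u : nat -> C) (l : C) :
  u O = RtoC 0 -> is_series (K := C_AbsRing) (V := C_NormedModule) u l ->
  is_series (K := C_AbsRing) (V := C_NormedModule) (fun k => u (S k)) l.
Proof.
intros H0 Hl; apply (is_series_incr_1 (V := C_NormedModule) u l).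
change (is_series (K := C_AbsRing) (V := C_NormedModule) u (l + u O)%C).
rewrite H0, Cplus_0_r; exact Hl.
Qed.

(** For rho strictly between |z| and the radius, the second-order bounds on the monomials sum to the
    twice derived series of moduli at rho, which converges. This gives one quadratic bound for the
    whole remainder. *)
Lemma is_C_derive_Cseries (a : nat -> C) (z : C) :
  Rbar_lt (Cmod z) (C_PS_radius a) ->
  is_derive (K := C_AbsRing) (V := C_NormedModule)
    (fun w => Cseries (fun k => a k * w ^ k)%C) z
    (Cseries (fun k => C_PS_derive a k * z ^ k)%C).
Proof.
intros Hz.
assert (Hrho : exists rho, Cmod z < rho /\ Rbar_lt rho (C_PS_radius a)).
{ destruct (C_PS_radius a) as [r| |]; simpl in Hz |- *.
  - exists ((Cmod z + r) / 2); lra.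
  - exists (Cmod z + 1); split; [lra | exact I].
  - contradiction. }
destruct Hrho as [rho [Hzr Hr]].
assert (Hrho : 0 <= rho) by (apply Rle_trans with (2 := Rlt_le _ _ Hzr), Cmod_ge_0).
set (b := fun k => Cmod (C_PS_derive (C_PS_derive a) k) * rho ^ k).
assert (Hb : ex_series b).
{ apply ex_series_C_PS_radius; [exact Hrho |].
  rewrite !C_PS_radius_derive; exact Hr. }
apply is_C_derive_of_quadratic_bound with (rho - Cmod z) (Series b); [lra |].
intros w Hw.
assert (Hwr : Cmod w < rho).
{ replace w with (w - z + z)%C by ring.
  apply Rle_lt_trans with (1 := Cmod_triangle _ _); lra. }
assert (HS : forall c y, Rbar_lt (Cmod y) (C_PS_radius c) ->
   is_series (K := C_AbsRing) (V := C_NormedModule) (fun k => c k * y ^ k)%C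
     (Cseries (fun k => c k * y ^ k)%C)).
{ intros c y Hc; apply Cseries_correct, ex_Cseries_C_PS_radius, Hc. }
assert (Sw : Rbar_lt (Cmod w) (C_PS_radius a))
  by (apply Rbar_lt_trans with (2 := Hr); exact Hwr).
assert (Hw1 := HS a w Sw).
assert (Hz1 := HS a z Hz).
assert (Hd1 := HS (C_PS_derive a) z ltac:(rewrite C_PS_radius_derive; exact Hz)).
set (A := Cseries (fun k => a k * w ^ k)%C) in *.
set (B := Cseries (fun k => a k * z ^ k)%C) in *.
set (D := Cseries (fun k => C_PS_derive a k * z ^ k)%C) in *.
rewrite <- Series_scal_r.
(* The remainders of degrees 0 and 1 vanish, so the sum starts at degree 2. *)
apply Cmod_is_series_le with (2 := ex_series_scal_r _ _ Hb)
  (u := fun k => (a (S (S k)) * w ^ S (S k) - a (S (S k)) * z ^ S (S k)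
                  - (w - z) * (C_PS_derive a (S k) * z ^ S k))%C).
- intros k; unfold b, C_PS_derive.
  replace (a (S (S k)) * w ^ S (S k) - a (S (S k)) * z ^ S (S k)
           - (w - z) * (RtoC (INR (S (S k))) * a (S (S k)) * z ^ S k))%C
    with (a (S (S k)) * (w ^ S (S k) - z ^ S (S k)
           - RtoC (INR (S (S k))) * z ^ S k * (w - z)))%C by ring.
  rewrite !Cmod_mult, !Cmod_R, !Rabs_pos_eq by apply pos_INR.
  eapply Rle_trans.
  + apply Rmult_le_compat_l; [apply Cmod_ge_0 |].
    apply Cpow_taylor2_bound with (rho := rho); apply Rlt_le; assumption.
  + right; ring.
- replace (A - B - D * (w - z))%C with (A - B - (w - z) * D)%C by ring.
  (* The first shift drops the constant terms and aligns degree k+1 with the k-th term of the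
     derived series; the second drops the vanishing linear remainder. *)
  assert (H1 := is_series_minus (V := C_NormedModule) _ _ _ _ Hw1 Hz1).
  assert (H2 := is_series_scal (V := C_NormedModule) (w - z)%C _ _ Hd1).
  apply is_Cseries_shift in H1; [| change (a O * 1 - a O * 1 = 0)%C; ring].
  assert (H3 := is_series_minus (V := C_NormedModule) _ _ _ _ H1 H2).
  apply is_Cseries_shift in H3; [exact H3 |].
  change (a 1%nat * (w * 1) - a 1%nat * (z * 1)
          - (w - z) * (RtoC 1 * a 1%nat * 1) = 0)%C; ring.
Qed.

Lemma C_PS_derive_iter (a : nat -> C) (m k : nat) :
  Nat.iter m C_PS_derive a k
  = (RtoC (INR (fact (m + k)) / INR (fact k)) * a (m + k)%nat)%C.
Proof.
revert k; induction m as [|m IH]; intros k.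
- simpl; replace (INR (fact k) / INR (fact k)) with 1 by (field; apply INR_fact_neq_0).
  rewrite Cmult_1_l; reflexivity.
- simpl Nat.iter; unfold C_PS_derive at 1; rewrite IH, Cmult_assoc, <- RtoC_mult.
  replace (m + S k)%nat with (S m + k)%nat by lia.
  f_equal; f_equal; rewrite (fact_simpl k), mult_INR; field.
  split; [apply INR_fact_neq_0 | apply not_0_INR; lia].
Qed.

(** The disc of convergence is open and formal differentiation keeps the radius, so the induction
    hypothesis applies on a whole neighbourhood of [z]. *)
Lemma is_C_derive_n_Cseries (a : nat -> C) (m : nat) (z : C) :
  Rbar_lt (Cmod z) (C_PS_radius a) ->
  is_C_derive_n (fun w => Cseries (fun k => a k * w ^ k)%C) m z
    (Cseries (fun k => Nat.iter m C_PS_derive a k * z ^ k)%C).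
Proof.
assert (Hrad : forall m, C_PS_radius (Nat.iter m C_PS_derive a) = C_PS_radius a).
{ intros j; induction j as [|j IH]; [reflexivity |].
  simpl; rewrite C_PS_radius_derive; exact IH. }
revert z; induction m as [|m IH]; intros z Hz; [reflexivity |].
exists (fun w => Cseries (fun k => Nat.iter m C_PS_derive a k * w ^ k)%C); split.
- apply (locally_C z).
  assert (Hd : exists d : posreal, forall w, Cmod (w - z) < d ->
                 Rbar_lt (Cmod w) (C_PS_radius a)).
  { assert (Htri : forall w, Cmod w <= Cmod (w - z) + Cmod z).
    { intros w; replace w with (w - z + z)%C at 1 by ring; apply Cmod_triangle. }
    destruct (C_PS_radius a) as [r| |]; simpl in Hz |- *.
    - assert (Hr : 0 < r - Cmod z) by lra.
      exists (mkposreal _ Hr); simpl; intros w Hw.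
      assert (Hw' := Htri w); lra.
    - exists (mkposreal _ Rlt_0_1); intros; exact I.
    - contradiction. }
  destruct Hd as [d Hd]; exists d; intros w Hw; apply IH, Hd, Hw.
- apply is_C_derive_Cseries; rewrite Hrad; exact Hz.
Qed.

(** The neighbourhood contains a point of modulus larger than |z|, which makes the inequality
    strict. *)
Lemma C_PS_radius_gt (a : nat -> C) (z : C) :
  locally z (fun w => ex_Cseries (fun k => a k * w ^ k)%C) ->
  Rbar_lt (Cmod z) (C_PS_radius a).
Proof.
intros H; apply (locally_C z) in H; destruct H as [d Hd].
assert (Hw : exists w, Cmod (w - z) < d /\ Cmod z < Cmod w).
{ assert (Hd0 := cond_pos d).
  (* Move by d/2 away from the origin: along the ray through [z], or along the real axis when [z] is
     0. *)
  destruct (Req_dec (Cmod z) 0) as [Hz|Hz].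
  - exists (z + RtoC (d / 2))%C; rewrite (Cmod_eq_0 z Hz), Cmod_0.
    replace (0 + RtoC (d / 2) - 0)%C with (RtoC (d / 2)) by ring.
    rewrite Cplus_0_l, Cmod_R, Rabs_pos_eq; lra.
  - assert (Hz0 := Cmod_ge_0 z).
    exists (z * RtoC (1 + d / 2 / Cmod z))%C.
    assert (0 < d / 2 / Cmod z) by (apply Rdiv_lt_0_compat; lra).
    replace (z * RtoC (1 + d / 2 / Cmod z) - z)%C
      with (z * RtoC (d / 2 / Cmod z))%C by (rewrite RtoC_plus; ring).
    rewrite !Cmod_mult, !Cmod_R, !Rabs_pos_eq by lra.
    assert (E : Cmod z * (d / 2 / Cmod z) = d / 2) by (field; exact Hz).
    rewrite Rmult_plus_distr_l, E; lra. }
destruct Hw as [w [Hwd Hw]].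
apply Rbar_lt_le_trans with (Cmod w); [exact Hw |].
apply C_PS_radius_ge, Hd, Hwd.
Qed.

(** * The functional equation of the Gamma function *)

Lemma is_RInt_gen_of_primitive {V : CompleteNormedModule R_AbsRing}
    (f F : R -> V) (Fa Fb : (R -> Prop) -> Prop) {FFa : Filter Fa} {FFb : Filter Fb}
    (la lb : V) :
  filter_prod Fa Fb
    (fun ab => is_RInt f (fst ab) (snd ab) (minus (F (snd ab)) (F (fst ab)))) ->
  filterlim F Fa (locally la) -> filterlim F Fb (locally lb) ->
  is_RInt_gen f Fa Fb (minus lb la).
Proof.
intros Hf Ha Hb P HP.
assert (Hlim : filterlim (fun ab : R * R => minus (F (snd ab)) (F (fst ab)))
                 (filter_prod Fa Fb) (locally (minus lb la))).
{ refine (filterlim_comp_2 (F := filter_prod Fa Fb) _ _ plus _ _ (filterlim_plus lb (opp la))).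
  - apply filterlim_comp with (1 := filterlim_snd) (2 := Hb).
  - apply filterlim_comp with (2 := filterlim_opp la).
    apply filterlim_comp with (1 := filterlim_fst) (2 := Ha). }
refine (filter_imp _ _ _ (filter_and _ (fun ab => P (minus (F (snd ab)) (F (fst ab))))
  Hf (Hlim P HP))).
intros ab [H1 H2]; exists (minus (F (snd ab)) (F (fst ab))); split; assumption.
Qed.

(** Serves to compare integrals over two intervals: [y] is the integral over one of them, [x] and
    [z] the pieces completing it to the other. *)
Lemma minus_plus_middle {G : AbelianGroup} (x y z : G) :
  minus (plus x (plus y z)) y = plus x z.
Proof.
unfold minus; rewrite <- !plus_assoc; f_equal.
rewrite (plus_comm z), plus_assoc.
transitivity (plus zero z); [| apply plus_zero_l].
apply (f_equal (fun t => plus t z)), plus_opp_r.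
Qed.

(** * Improper integrals dominated by a derivative *)

Section Domination.

Context {V : CompleteNormedModule R_AbsRing}.
Variables (f : R -> V) (G g : R -> R) (a : R).
Hypothesis f_cont : forall t, a < t -> continuous f t.
Hypothesis G_deriv : forall t, a < t -> is_derive G t (g t).
Hypothesis g_cont : forall t, a < t -> continuous g t.
Hypothesis f_le_g : forall t, a < t -> norm (f t) <= g t.

Lemma ex_RInt_dominated (u v : R) : a < u -> a < v -> ex_RInt f u v.
Proof.
intros Hu Hv; apply (ex_RInt_continuous (V := V)); intros t [Ht _]; apply f_cont.
apply Rlt_le_trans with (2 := Ht), Rmin_glb_lt; assumption.
Qed.

Lemma norm_RInt_dominated (u v : R) :
  a < u -> a < v -> norm (RInt f u v) <= Rabs (G v - G u).
Proof.
assert (H : forall u v, a < u -> u <= v -> norm (RInt f u v) <= Rabs (G v - G u)).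
{ intros u' v' Hu Huv.
  apply Rle_trans with (2 := Rle_abs _).
  apply (norm_RInt_le f g u' v' _ _ Huv).
  - intros t Ht; apply f_le_g; lra.
  - apply (RInt_correct (V := V)), ex_RInt_dominated; lra.
  - apply (is_RInt_derive (V := R_CompleteNormedModule) G g);
      rewrite Rmin_left by exact Huv; intros t Ht;
      [apply G_deriv | apply g_cont]; lra. }
intros Hu Hv; destruct (Rle_dec u v) as [Huv|Huv]; [apply H; assumption |].
rewrite <- (opp_RInt_swap f v u) by (apply ex_RInt_dominated; assumption).
rewrite Rabs_minus_sym; eapply Rle_trans; [right; apply (norm_opp (RInt f v u)) |].
apply H; lra.
Qed.

(** Cauchy criterion: moving an endpoint changes the integral by at most the variation of [G], which
    is small near both ends because [G] has limits there. Completeness of [V] then provides the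
    value. *)
Lemma ex_RInt_gen_dominated (la lb : R) :
  filterlim G (at_right a) (locally la) ->
  filterlim G (Rbar_locally p_infty) (locally lb) ->
  ex_RInt_gen f (at_right a) (Rbar_locally p_infty).
Proof.
intros Ha Hb.
set (F := filter_prod (at_right a) (Rbar_locally p_infty)).
assert (Hpos : F (fun ab => a < fst ab /\ a < snd ab)).
{ apply Filter_prod with (fun t => a < t) (fun t => a < t).
  - exists (mkposreal _ Rlt_0_1); intros t _ Ht; exact Ht.
  - exists a; intros t Ht; exact Ht.
  - intros u v Hu Hv; split; assumption. }
assert (Hc : forall eps : posreal, exists P, F P /\
   forall x y, P x -> P y ->
   ball (M := V) (RInt f (fst x) (snd x)) eps (RInt f (fst y) (snd y))).
{ intros eps.
  (* Two end pieces, on each of which two values of [G] lie within [e] of the same limit: four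
     errors in all. *)
  assert (He : 0 < eps / 4) by (apply Rdiv_lt_0_compat; [apply cond_pos | lra]).
  set (e := mkposreal _ He).
  set (P0 := fun ab => Rabs (G (fst ab) - la) < e /\ Rabs (G (snd ab) - lb) < e).
  exists (fun ab => (a < fst ab /\ a < snd ab) /\ P0 ab); split.
  - apply filter_and; [exact Hpos |].
    apply Filter_prod with (fun t => Rabs (G t - la) < e) (fun t => Rabs (G t - lb) < e).
    + apply (Ha (fun y => Rabs (y - la) < e)); exists e; intros y Hy; exact Hy.
    + apply (Hb (fun y => Rabs (y - lb) < e)); exists e; intros y Hy; exact Hy.
    + intros u v Hu Hv; split; assumption.
  - intros [u v] [u' v'] [[Hu Hv] [H1 H2]] [[Hu' Hv'] [H3 H4]]; simpl in *.
    apply (norm_compat1 (V := V)).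
    rewrite <- (RInt_Chasles f u' u v') by (apply ex_RInt_dominated; assumption).
    rewrite <- (RInt_Chasles f u v v') by (apply ex_RInt_dominated; assumption).
    apply Rle_lt_trans with (norm (plus (RInt f u' u) (RInt f v v'))).
    + right; apply f_equal, (minus_plus_middle (G := V)).
    + eapply Rle_lt_trans; [apply (norm_triangle (V := V)) |].
      assert (N1 := norm_RInt_dominated u' u Hu' Hu).
      assert (N2 := norm_RInt_dominated v v' Hv Hv').
      apply Rle_lt_trans with (1 := Rplus_le_compat _ _ _ _ N1 N2); clear N1 N2.
      revert H1 H2 H3 H4.
      unfold Rabs; repeat destruct Rcase_abs; intros; lra. }
apply (proj1 (filterlim_locally_cauchy (U := V) (F := F) (fun ab => RInt f (fst ab) (snd ab))))
  in Hc.
destruct Hc as [l Hl]; exists l; intros P HP.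
refine (filter_imp _ _ _ (filter_and _ (fun ab => P (RInt f (fst ab) (snd ab)))
  Hpos (Hl P HP))).
intros [u v] [[Hu Hv] H]; exists (RInt f u v); split; [| exact H].
apply (RInt_correct (V := V)), ex_RInt_dominated; assumption.
Qed.

End Domination.

(** * Complex-valued integrals and Euler's integrand *)

Lemma norm_C_R (z : C) : norm (V := C_R_NormedModule) z = Cmod z.
Proof.
destruct z as [x y]; unfold Cmod; simpl fst; simpl snd.
rewrite <- (pow2_abs x), <- (pow2_abs y); reflexivity.
Qed.

Lemma filterlim_C_0_le {T : Type} (F : (T -> Prop) -> Prop) {FF : Filter F}
    (f : T -> C) (g : T -> R) :
  F (fun t => Cmod (f t) <= g t) -> filterlim g F (locally 0) ->
  filterlim f F (locally (T := C_R_NormedModule) (RtoC 0)).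
Proof.
intros Hfg Hg P [eps HP].
assert (He : F (fun t => g t < eps)).
{ apply (Hg (fun y => y < eps)); exists eps; intros y Hy.
  apply Rle_lt_trans with (1 := Rle_abs y).
  change (Rabs (y - 0) < eps) in Hy; rewrite Rminus_0_r in Hy; exact Hy. }
apply filter_imp with (2 := filter_and _ _ Hfg He); intros t [H1 H2].
apply HP, (norm_compat1 (V := C_R_NormedModule)).
rewrite norm_C_R; change (Cmod (f t - RtoC 0) < eps).
replace (f t - RtoC 0)%C with (f t) by ring; lra.
Qed.

(** The integral is linear over real scalars, so a complex factor is handled through real and
    imaginary parts. *)
Lemma is_RInt_Cmult (c : C) (f : R -> C) (u v : R) (l : C) :
  is_RInt (V := C_R_NormedModule) f u v l ->
  is_RInt (V := C_R_NormedModule) (fun t => c * f t)%C u v (c * l)%C.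
Proof.
intros H.
assert (H1 := is_RInt_fct_extend_fst (U := R_NormedModule) (V := R_NormedModule) f u v l H).
assert (H2 := is_RInt_fct_extend_snd (U := R_NormedModule) (V := R_NormedModule) f u v l H).
apply (is_RInt_fct_extend_pair (U := R_NormedModule) (V := R_NormedModule)).
- exact (is_RInt_minus _ _ _ _ _ _ (is_RInt_scal _ _ _ (fst c) _ H1)
           (is_RInt_scal _ _ _ (snd c) _ H2)).
- exact (is_RInt_plus _ _ _ _ _ _ (is_RInt_scal _ _ _ (fst c) _ H2)
           (is_RInt_scal _ _ _ (snd c) _ H1)).
Qed.

Lemma is_RInt_gen_Cmult (c : C) (f : R -> C) (Fa Fb : (R -> Prop) -> Prop)
    {FFa : Filter Fa} {FFb : Filter Fb} (l : C) :
  is_RInt_gen (V := C_R_NormedModule) f Fa Fb l ->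
  is_RInt_gen (V := C_R_NormedModule) (fun t => c * f t)%C Fa Fb (c * l)%C.
Proof.
intros H P HP.
assert (HQ : locally (T := C_R_NormedModule) l (fun y => P (c * y)%C))
  by exact (filterlim_scal_r (V := C_NormedModule) c l P HP).
assert (HF : filter_prod Fa Fb (fun ab => exists y : C,
   is_RInt (V := C_R_NormedModule) f (fst ab) (snd ab) y /\ P (c * y)%C)) by exact (H _ HQ).
apply filter_imp with (2 := HF); intros ab [y [Hy Py]].
exists (c * y)%C; split; [apply is_RInt_Cmult, Hy | exact Py].
Qed.

(* [t ^ a * exp (- t)], meaningful for [t > 0] only. *)
Definition pow_exp (a : C) (t : R) : C :=
  (exp (Re a * ln t - t) * cos (Im a * ln t),
   exp (Re a * ln t - t) * sin (Im a * ln t)).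

Lemma Cmod_pow_exp (a : C) (t : R) : Cmod (pow_exp a t) = exp (Re a * ln t - t).
Proof.
unfold Cmod, pow_exp; simpl fst; simpl snd.
set (e := exp _); set (x := Im a * ln t).
replace ((e * cos x) ^ 2 + (e * sin x) ^ 2) with (e ^ 2 * (Rsqr (sin x) + Rsqr (cos x)))
  by (unfold Rsqr; ring).
rewrite sin2_cos2, Rmult_1_r; apply sqrt_pow2, Rlt_le, exp_pos.
Qed.

(** True for every real [t], even where [ln t] and [/ t] are default values, since 0 / t is 0 times
    something. The integrands can therefore be identified as functions. *)
Lemma pow_exp_inc_Gamma (a : C) (t : R) :
  (Cexp ((a - 1) * RtoC (ln t)) * Cexp (- RtoC t - 0 / RtoC t))%C = pow_exp (a - 1) t.
Proof.
replace (- RtoC t - 0 / RtoC t)%C with (RtoC (- t))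
  by (unfold Cdiv; rewrite Cmult_0_l, RtoC_opp; ring).
unfold Cexp, pow_exp.
rewrite re_scal_r, im_scal_r, re_RtoC, im_RtoC, cos_0, sin_0.
unfold Rminus at 1 2; rewrite exp_plus.
unfold Cmult, RtoC; simpl; f_equal; ring.
Qed.

Lemma pow_exp_continuous (a : C) (t : R) :
  0 < t -> continuous (U := C_R_NormedModule) (pow_exp a) t.
Proof.
intros Ht.
apply (continuous_comp_2 (U := R_UniformSpace) (V := R_UniformSpace) (W := R_UniformSpace)
  (X := C_R_NormedModule) (fun t => exp (Re a * ln t - t) * cos (Im a * ln t))
  (fun t => exp (Re a * ln t - t) * sin (Im a * ln t)) (fun x y => (x, y))).
- apply (ex_derive_continuous (V := R_NormedModule)); auto_derive; repeat split; exact Ht.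
- apply (ex_derive_continuous (V := R_NormedModule)); auto_derive; repeat split; exact Ht.
- intros P HP; refine (filter_imp _ _ _ HP); intros [x y]; exact (fun H => H).
Qed.

(** From 1 + y <= e^y at y = ln (t / M). It lets e^(-t) absorb a power of t with an explicit
    constant. *)
Lemma Rmult_ln_le (M t : R) : 0 < M -> 0 < t -> M * ln t <= t + M * ln M.
Proof.
intros HM Ht.
assert (Hq : 0 < t / M) by (apply Rdiv_lt_0_compat; assumption).
assert (H := exp_ineq1_le (ln (t / M))).
rewrite exp_ln, ln_div in H by assumption.
assert (H' : M * (1 + (ln t - ln M)) <= M * (t / M))
  by (apply Rmult_le_compat_l; [lra | exact H]).
replace (M * (t / M)) with t in H' by (field; lra).
nra.
Qed.

Lemma filterlim_pow_0 (s : R) :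
  0 < s -> filterlim (fun t => exp (s * ln t)) (at_right 0) (locally 0).
Proof.
intros Hs; apply filterlim_comp with (2 := is_lim_exp_m).
apply filterlim_comp with (1 := is_lim_ln_0).
intros P [M HM]; exists (M / s); intros y Hy; apply HM.
rewrite Rmult_comm; apply Rlt_div_r; assumption.
Qed.

Lemma filterlim_pow_p (s : R) :
  0 < s -> filterlim (fun t => exp (s * ln t)) (Rbar_locally p_infty) (Rbar_locally p_infty).
Proof.
intros Hs; apply filterlim_comp with (2 := is_lim_exp_p).
apply filterlim_comp with (1 := is_lim_ln_p).
intros P [M HM]; exists (M / s); intros y Hy; apply HM.
rewrite Rmult_comm; apply Rlt_div_l; assumption.
Qed.

Lemma filterlim_pow_exp_0 (a : C) :
  0 < Re a ->
  filterlim (pow_exp a) (at_right 0) (locally (T := C_R_NormedModule) (RtoC 0)).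
Proof.
intros Ha; apply filterlim_C_0_le with (3 := filterlim_pow_0 (Re a) Ha);
  [apply at_right_proper_filter |].
exists (mkposreal _ Rlt_0_1); intros t _ Ht; rewrite Cmod_pow_exp.
apply Rlt_le, exp_increasing; lra.
Qed.

Lemma filterlim_pow_exp_p (a : C) :
  0 < Re a ->
  filterlim (pow_exp a) (Rbar_locally p_infty) (locally (T := C_R_NormedModule) (RtoC 0)).
Proof.
(* [Rmult_ln_le] with M = 2 Re a, halved, gives Re a ln t <= t/2 + c, so half of the exponential
   decay survives. *)
intros Ha; set (c := Re a * ln (2 * Re a)).
apply filterlim_C_0_le with (fun t => exp (c - t / 2)); [apply Rbar_locally_filter | |].
- exists 0; intros t Ht; rewrite Cmod_pow_exp.
  assert (H := Rmult_ln_le (2 * Re a) t ltac:(lra) Ht).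
  assert (H' : Re a * ln t - t <= c - t / 2) by (unfold c; lra).
  destruct H' as [H'|H']; [left; apply exp_increasing, H' | right; rewrite H'; reflexivity].
- apply filterlim_comp with (2 := is_lim_exp_m).
  intros P [M HM]; exists (2 * (c - M)); intros t Ht; apply HM; lra.
Qed.

(* The dominating function is the derivative of [- K / (1 + t ^ s)], where [s = Re a + 1]:
   it behaves like [t ^ (s - 1)] at [0] and like [t ^ (- s - 1)] at infinity. *)
Lemma ex_RInt_gen_pow_exp (a : C) :
  0 < Re a + 1 ->
  ex_RInt_gen (V := C_R_NormedModule) (pow_exp a) (at_right 0) (Rbar_locally p_infty).
Proof.
set (s := Re a + 1); intros Hs.
(* Chosen so that K s = 2 (1 + (2s)^(2s)), where (2s)^(2s) bounds t^(2s) e^(-t). *)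
set (K := 2 * (1 + exp (2 * s * ln (2 * s))) / s).
assert (HK : 0 < K).
{ apply Rdiv_lt_0_compat; [| exact Hs].
  assert (H := exp_pos (2 * s * ln (2 * s))); lra. }
apply (ex_RInt_gen_dominated (V := C_R_CompleteNormedModule) (pow_exp a)
  (fun t => - K * / (1 + exp (s * ln t)))
  (fun t => K * s * exp (s * ln t) / t / (1 + exp (s * ln t)) ^ 2) 0)
  with (la := - K * / (1 + 0)) (lb := 0).
- apply pow_exp_continuous.
- intros t Ht; assert (He := exp_pos (s * ln t)).
  auto_derive; [repeat split; lra | field; lra].
- intros t Ht; assert (He := exp_pos (s * ln t)).
  apply (ex_derive_continuous (V := R_NormedModule)); auto_derive.
  repeat split; try lra; try (apply Rgt_not_eq); nra.
- intros t Ht; eapply Rle_trans; [right; apply norm_C_R |].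
  rewrite Cmod_pow_exp.
  replace (Re a * ln t - t) with (s * ln t + (- ln t) + - t) by (unfold s; ring).
  rewrite !exp_plus, (exp_Ropp (ln t)), exp_ln by exact Ht.
  assert (He := exp_pos (s * ln t)).
  assert (H := Rmult_ln_le (2 * s) t ltac:(lra) Ht).
  assert (H1 : exp (s * ln t) * exp (s * ln t) * exp (- t) <= exp (2 * s * ln (2 * s))).
  { rewrite <- !exp_plus.
    destruct (Rle_lt_or_eq_dec (s * ln t + s * ln t + - t) (2 * s * ln (2 * s)) ltac:(lra))
      as [H'|H']; [left; apply exp_increasing, H' | right; rewrite H'; reflexivity]. }
  assert (H2 : exp (- t) <= 1) by (rewrite <- exp_0; left; apply exp_increasing; lra).
  assert (H3 := exp_pos (- t)).
  set (f := exp (s * ln t)) in *; set (e := exp (- t)) in *.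
  (* Uses (1 + f)^2 = 2 (1 + f^2) - (1 - f)^2, with [H1] bounding f^2 e and [H2] bounding e. *)
  assert (H4 : e * (1 + f) ^ 2 <= K * s).
  { replace (K * s) with (2 * (1 + exp (2 * s * ln (2 * s)))) by (unfold K; field; lra).
    assert (0 <= e * (1 - f) ^ 2) by (apply Rmult_le_pos; [lra | apply pow2_ge_0]).
    nra. }
  assert (Hp : 0 < (1 + f) ^ 2) by (apply pow_lt; lra).
  replace (f * / t * e) with (f / t * e) by reflexivity.
  replace (K * s * f / t / (1 + f) ^ 2) with (f / t * (K * s / (1 + f) ^ 2))
    by (field; lra).
  apply Rmult_le_compat_l; [left; apply Rdiv_lt_0_compat; lra |].
  apply Rle_div_r; assumption.
- apply filterlim_comp with (1 := filterlim_pow_0 s Hs) (g := fun y => - K * / (1 + y)).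
  apply (ex_derive_continuous (V := R_NormedModule) (fun y => - K * / (1 + y)) 0).
  auto_derive; lra.
- apply filterlim_comp with (1 := filterlim_pow_p s Hs) (g := fun y => - K * / (1 + y)).
  assert (H : is_lim (fun y => - K * / (1 + y)) p_infty (Rbar_mult (- K) (Rbar_inv p_infty))).
  { apply is_lim_scal_l, is_lim_inv; [| discriminate].
    apply is_lim_plus with (lf := 1) (lg := p_infty);
      [apply is_lim_const | apply is_lim_id | reflexivity]. }
  simpl in H; rewrite Rmult_0_r in H; exact H.
Qed.

(** Integration by parts in the form of a primitive: the integrand is the derivative of t^a e^(-t),
    checked on each component. *)
Lemma is_RInt_pow_exp_parts (a : C) (u v : R) :
  0 < u -> 0 < v ->
  is_RInt (V := C_R_NormedModule) (fun t => a * pow_exp (a - 1) t - pow_exp a t)%C u v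
    (pow_exp a v - pow_exp a u)%C.
Proof.
intros Hu Hv.
assert (Hpos : forall t, Rmin u v <= t <= Rmax u v -> 0 < t).
{ intros t [Ht _]; apply Rlt_le_trans with (2 := Ht), Rmin_glb_lt; assumption. }
assert (E : forall t, 0 < t -> exp (Re (a - 1) * ln t - t) = exp (Re a * ln t - t) / t).
{ intros t Ht.
  replace (Re (a - 1) * ln t - t) with (Re a * ln t - t + - ln t)
    by (destruct a; simpl; ring).
  rewrite exp_plus, exp_Ropp, exp_ln by exact Ht; reflexivity. }
assert (I : Im (a - 1) = Im a) by (destruct a; simpl; ring).
apply (is_RInt_fct_extend_pair (U := R_NormedModule) (V := R_NormedModule)).
- apply (is_RInt_derive (V := R_CompleteNormedModule) (fun t => fst (pow_exp a t))).
  + intros t Ht; apply Hpos in Ht; unfold pow_exp; rewrite I, (E t Ht).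
    destruct a as [x y]; simpl.
    auto_derive; [repeat split; exact Ht | unfold Rminus; field; lra].
  + intros t Ht; apply Hpos in Ht; unfold pow_exp; rewrite I.
    destruct a as [x y]; simpl.
    apply (ex_derive_continuous (V := R_NormedModule)); auto_derive; repeat split; exact Ht.
- apply (is_RInt_derive (V := R_CompleteNormedModule) (fun t => snd (pow_exp a t))).
  + intros t Ht; apply Hpos in Ht; unfold pow_exp; rewrite I, (E t Ht).
    destruct a as [x y]; simpl.
    auto_derive; [repeat split; exact Ht | unfold Rminus; field; lra].
  + intros t Ht; apply Hpos in Ht; unfold pow_exp; rewrite I.
    destruct a as [x y]; simpl.
    apply (ex_derive_continuous (V := R_NormedModule)); auto_derive; repeat split; exact Ht.
Qed.

Lemma inc_Gamma_is_RInt_gen (a : C) :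
  0 < Re a ->
  is_RInt_gen (V := C_R_NormedModule) (pow_exp (a - 1)) (at_right 0) (Rbar_locally p_infty)
    (inc_Gamma a 0 0).
Proof.
intros Ha.
assert (Hs : 0 < Re (a - 1) + 1) by (destruct a; simpl in *; lra).
assert (E : inc_Gamma a 0 0 = RInt_gen (V := C_R_CompleteNormedModule) (pow_exp (a - 1))
                                (at_right 0) (Rbar_locally p_infty)).
{ unfold inc_Gamma; apply f_equal3; [| reflexivity | reflexivity].
  apply functional_extensionality.
  intros t; apply pow_exp_inc_Gamma. }
rewrite E; apply (RInt_gen_correct (V := C_R_CompleteNormedModule)).
apply ex_RInt_gen_pow_exp, Hs.
Qed.

(** The boundary values of t^a e^(-t) vanish at 0 and at infinity because Re a > 0, so the integral
    of a t^(a-1) e^(-t) - t^a e^(-t) is 0. *)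
Lemma inc_Gamma_succ (a : C) :
  0 < Re a -> inc_Gamma (a + 1) 0 0 = (a * inc_Gamma a 0 0)%C.
Proof.
intros Ha.
assert (Hl := inc_Gamma_is_RInt_gen a Ha).
assert (Ha' : 0 < Re (a + 1)) by (destruct a; simpl in *; lra).
assert (Hl' := inc_Gamma_is_RInt_gen (a + 1) Ha').
replace (a + 1 - 1)%C with a in Hl' by ring.
assert (Hpos : filter_prod (at_right 0) (Rbar_locally p_infty)
                 (fun ab => 0 < fst ab /\ 0 < snd ab)).
{ apply Filter_prod with (fun t => 0 < t) (fun t => 0 < t).
  - exists (mkposreal _ Rlt_0_1); intros t _ Ht; exact Ht.
  - exists 0; intros t Ht; exact Ht.
  - intros u v Hu Hv; split; assumption. }
assert (H0 : is_RInt_gen (V := C_R_NormedModule)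
   (fun t => a * pow_exp (a - 1) t - pow_exp a t)%C (at_right 0) (Rbar_locally p_infty)
   (RtoC 0 - RtoC 0)%C).
{ apply (is_RInt_gen_of_primitive (V := C_R_CompleteNormedModule) _ (pow_exp a));
    [apply at_right_proper_filter | apply Rbar_locally_filter |
     | apply filterlim_pow_exp_0, Ha | apply filterlim_pow_exp_p, Ha].
  apply filter_imp with (2 := Hpos); intros [u v] [Hu Hv].
  apply is_RInt_pow_exp_parts; assumption. }
assert (H1 := is_RInt_gen_minus (V := C_R_NormedModule) _ _ _ _
                (is_RInt_gen_Cmult a _ _ _ _ Hl) Hl').
assert (E : (RtoC 0 - RtoC 0 = a * inc_Gamma a 0 0 - inc_Gamma (a + 1) 0 0)%C)
  by exact (eq_trans (eq_sym (is_RInt_gen_unique (V := C_R_CompleteNormedModule) _ _ H0))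
                     (is_RInt_gen_unique (V := C_R_CompleteNormedModule) _ _ H1)).
symmetry; apply Ceq_minus; rewrite <- E; ring.
Qed.

(** * Pochhammer symbols and the continued Gamma function *)

Lemma nonpos_int_shift (a : C) (n : nat) : nonpos_int (a + RtoC (INR n)) -> nonpos_int a.
Proof.
intros [k Hk]; exists (n + k)%nat.
rewrite plus_INR, RtoC_plus.
replace a with (a + RtoC (INR n) - RtoC (INR n))%C by ring; rewrite Hk; ring.
Qed.

Lemma Cpoch_neq_0 (a : C) (n : nat) : ~ nonpos_int a -> Cpoch a n <> RtoC 0.
Proof.
intros Ha; induction n as [|n IH]; [exact C1_nz |].
apply Cmult_neq_0; [exact IH |]; intros E; apply Ha; exists n.
replace a with (a + RtoC (INR n) - RtoC (INR n))%C by ring; rewrite E; ring.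
Qed.

Lemma Cpoch_add (a : C) (n k : nat) :
  Cpoch a (n + k) = (Cpoch a n * Cpoch (a + RtoC (INR n)) k)%C.
Proof.
induction k as [|k IH].
- rewrite Nat.add_0_r; simpl; ring.
- rewrite Nat.add_succ_r; simpl; rewrite IH, plus_INR, RtoC_plus; ring.
Qed.

Lemma Cpoch_nonpos_int (k n : nat) : (k < n)%nat -> Cpoch (- RtoC (INR k)) n = RtoC 0.
Proof.
intros H; replace n with (S k + (n - S k))%nat by lia.
rewrite Cpoch_add; simpl; ring.
Qed.

Lemma CGamma_succ (a : C) : ~ nonpos_int a -> CGamma (a + 1) = (a * CGamma a)%C.
Proof.
intros Ha; unfold CGamma.
assert (Ha0 : a <> RtoC 0) by (intros E; apply Ha; exists O; rewrite E; simpl; ring).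
assert (Hup : up (- Re (a + 1)) = (up (- Re a) - 1)%Z).
{ symmetry; apply tech_up; destruct (archimed (- Re a)) as [H1 H2];
    rewrite minus_IZR; destruct a; simpl in *; lra. }
rewrite Hup; clear Hup.
destruct (Z.le_gt_cases (up (- Re a)) 0) as [Hz|Hz].
- replace (Z.to_nat (up (- Re a) - 1)) with O by lia.
  replace (Z.to_nat (up (- Re a))) with O by lia.
  simpl Cpoch; simpl INR; rewrite !Cplus_0_r.
  rewrite inc_Gamma_succ; [field |].
  apply IZR_le in Hz; destruct (archimed (- Re a)) as [H1 _]; lra.
- set (k := Z.to_nat (up (- Re a) - 1)).
  replace (Z.to_nat (up (- Re a))) with (1 + k)%nat by (unfold k; lia).
  rewrite Cpoch_add; simpl (Cpoch a 1); simpl (INR 1).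
  replace (a + RtoC (INR (1 + k)))%C with (a + 1 + RtoC (INR k))%C
    by (rewrite plus_INR, RtoC_plus; simpl; ring).
  assert (Hk : Cpoch (a + 1) k <> RtoC 0).
  { apply Cpoch_neq_0; intros H; apply Ha, (nonpos_int_shift a 1), H. }
  simpl (RtoC (INR 0)); field; split; assumption.
Qed.

Lemma CGamma_shift (a : C) (n : nat) :
  ~ nonpos_int a -> CGamma (a + RtoC (INR n)) = (Cpoch a n * CGamma a)%C.
Proof.
intros Ha; induction n as [|n IH].
- simpl; rewrite Cplus_0_r; ring.
- rewrite S_INR, RtoC_plus, Cplus_assoc, CGamma_succ.
  + rewrite IH; simpl; ring.
  + intros H; apply Ha, (nonpos_int_shift a n), H.
Qed.

(* [w = 0] is allowed because [/ 0 = 0] in [C]; this saves proving that Gamma has no zeros. *)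
Lemma Cinv_mult_nz_l (z w : C) : z <> RtoC 0 -> (/ (z * w))%C = (/ z * / w)%C.
Proof.
intros Hz; destruct (Ceq_dec w 0) as [Hw|Hw].
- assert (E : (/ RtoC 0)%C = RtoC 0)
    by (unfold Cinv, RtoC, Rdiv; simpl; f_equal; ring).
  rewrite Hw, Cmult_0_r, E; ring.
- field; split; assumption.
Qed.

Lemma inv_CGamma_shift (a : C) (n : nat) :
  inv_CGamma a = (Cpoch a n * inv_CGamma (a + RtoC (INR n)))%C.
Proof.
unfold inv_CGamma.
destruct (excluded_middle_informative (nonpos_int a)) as [Ha|Ha];
  destruct (excluded_middle_informative (nonpos_int (a + RtoC (INR n)))) as [Hn|Hn].
- ring.
- destruct Ha as [k Hk]; destruct (Nat.lt_ge_cases k n) as [H|H].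
  + rewrite Hk, (Cpoch_nonpos_int k n H); ring.
  + exfalso; apply Hn; exists (k - n)%nat; rewrite Hk, minus_INR, RtoC_minus by exact H; ring.
- exfalso; apply Ha, (nonpos_int_shift a n), Hn.
- rewrite CGamma_shift by exact Ha.
  rewrite Cinv_mult_nz_l by (apply Cpoch_neq_0, Ha).
  rewrite Cmult_assoc, Cinv_r by (apply Cpoch_neq_0, Ha); ring.
Qed.

(** * Coefficients of the hypergeometric series *)

Lemma inc_poch_shift (a : C) (x : R) (p : C) (n k : nat) :
  inc_poch a x p (n + k) = (Cpoch a n * inc_poch (a + RtoC (INR n)) x p k)%C.
Proof.
unfold inc_poch; rewrite (inv_CGamma_shift a n), plus_INR, RtoC_plus, Cplus_assoc; ring.
Qed.

Lemma Cpoch_prod_shift (l : list C) (n k : nat) :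
  Cpoch_prod l (n + k) = (Cpoch_prod l n * Cpoch_prod (Cshift n l) k)%C.
Proof.
induction l as [|a l IH]; [simpl; ring |].
change (Cpoch a (n + k) * Cpoch_prod l (n + k)
  = Cpoch a n * Cpoch_prod l n
    * (Cpoch (a + RtoC (INR n)) k * Cpoch_prod (Cshift n l) k))%C.
rewrite IH, Cpoch_add; ring.
Qed.

Lemma Cpoch_prod_neq_0 (l : list C) (n : nat) :
  (forall b, In b l -> ~ nonpos_int b) -> Cpoch_prod l n <> RtoC 0.
Proof.
intros H; induction l as [|b l IH]; [exact C1_nz |].
apply Cmult_neq_0; [apply Cpoch_neq_0, H; left; reflexivity |].
apply IH; intros c Hc; apply H; right; exact Hc.
Qed.

Definition rGammas_coeff (alpha1 : C) (alphas betas : list C) (x : R) (p : C)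
    (k : nat) : C :=
  (inc_poch alpha1 x p k * Cpoch_prod alphas k / Cpoch_prod betas k
   / RtoC (INR (fact k)))%C.

Lemma rGammas_term_coeff (alpha1 : C) (alphas betas : list C) (x : R) (p z : C) (k : nat) :
  rGammas_term alpha1 alphas betas x p z k
  = (rGammas_coeff alpha1 alphas betas x p k * z ^ k)%C.
Proof. unfold rGammas_term, rGammas_coeff, Cdiv; ring. Qed.

Lemma rGammas_coeff_shift (alpha1 : C) (alphas betas : list C) (x : R) (p : C) (n k : nat) :
  (forall b, In b betas -> ~ nonpos_int b) ->
  (RtoC (INR (fact (n + k)) / INR (fact k)) * rGammas_coeff alpha1 alphas betas x p (n + k))%C
  = (Cpoch_prod (alpha1 :: alphas) n / Cpoch_prod betas n
     * rGammas_coeff (alpha1 + RtoC (INR n)) (Cshift n alphas) (Cshift n betas) x p k)%C.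
Proof.
intros Hb; unfold rGammas_coeff.
assert (Hf : forall j, RtoC (INR (fact j)) <> RtoC 0)
  by (intros j H; apply (INR_fact_neq_0 j), RtoC_inj, H).
assert (H := Cpoch_prod_neq_0 betas (n + k) Hb).
rewrite Cpoch_prod_shift in H.
rewrite RtoC_div by apply INR_fact_neq_0.
rewrite inc_poch_shift, !Cpoch_prod_shift.
change (Cpoch_prod (alpha1 :: alphas) n) with (Cpoch alpha1 n * Cpoch_prod alphas n)%C.
field; repeat split; try apply Hf; intros E; apply H; rewrite E; ring.
Qed.

Theorem theorem3
    (alpha1 : C) (alphas betas : list C) (x : R) (p z : C) (n : nat)
    (Hbetas : forall b : C, In b betas -> ~ nonpos_int b)
    (Hx : (0 <= x)%R)
    (Hp : (0 < Re p)%R \/ p = 0)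
    (Hpx : p = 0 -> x = 0%R -> (0 < Re alpha1)%R)
    (Hleft : locally z (fun w : C =>
       ex_Cseries (rGammas_term alpha1 alphas betas x p w)))
    (Hright : ex_Cseries
       (rGammas_term (alpha1 + RtoC (INR n)) (Cshift n alphas) (Cshift n betas)
          x p z)) :
  is_C_derive_n (fun w : C => rGammas alpha1 alphas betas x p w) n z
    (Cpoch_prod (alpha1 :: alphas) n / Cpoch_prod betas n
     * rGammas (alpha1 + RtoC (INR n)) (Cshift n alphas) (Cshift n betas)
         x p z).
Proof.
set (a := rGammas_coeff alpha1 alphas betas x p).
assert (Hf : (fun w => rGammas alpha1 alphas betas x p w)
             = (fun w => Cseries (fun k => a k * w ^ k)%C)).
{ apply functional_extensionality; intros w.
  apply Cseries_ext; intros k; apply rGammas_term_coeff. }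
rewrite Hf; clear Hf.
assert (Hrad : Rbar_lt (Cmod z) (C_PS_radius a)).
{ apply C_PS_radius_gt.
  apply filter_imp with (2 := Hleft); intros w [l Hl]; exists l.
  apply is_series_ext with (2 := Hl); intros k; apply rGammas_term_coeff. }
set (c := (Cpoch_prod (alpha1 :: alphas) n / Cpoch_prod betas n)%C).
replace (c * rGammas (alpha1 + RtoC (INR n)) (Cshift n alphas) (Cshift n betas) x p z)%C
  with (Cseries (fun k => Nat.iter n C_PS_derive a k * z ^ k)%C).
- apply is_C_derive_n_Cseries, Hrad.
- apply is_Cseries_unique.
  apply is_series_ext with
    (2 := is_series_scal (V := C_NormedModule) c _ _ (Cseries_correct _ Hright)).
  intros k; rewrite C_PS_derive_iter; unfold a.
  rewrite rGammas_coeff_shift by exact Hbetas.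
  rewrite rGammas_term_coeff; apply Cmult_assoc.
Qed.
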